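(* Let $f$, $g$, $h$ and $k$ be maps from a metric space $(\mathcal{X},d)$ into itself. Suppose that each of the pairs $(f,h)$ and $(g,k)$ is compatible and subsequentially continuous. Then (a) $f$ and $h$ have a coincidence point; (b) $g$ and $k$ have a coincidence point. Moreover, suppose that for all $x,y\in\mathcal{X}$ $$d^{p}(fx,gy)\leq F\Big(a\,d^{p}(hx,ky)+(1-a)\max\big\{\alpha d^{p}(fx,hx),\ \beta d^{p}(gy,ky),\ d^{\frac p2}(fx,hx)d^{\frac p2}(fx,ky),\ d^{\frac p2}(fx,ky)d^{\frac p2}(hx,gy),\ \tfrac12\big(d^{p}(fx,hx)+d^{p}(gy,ky)\big)\big\}\Big),$$ where $0<a<1$, $\alpha,\beta\in(0,1]$, $p\in\mathbb{N}^{*}$ and $F\in\mathcal{F}$. Then $f$, $g$, $h$ and $k$ have a unique common fixed point.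
   Context: $\mathbb{R}^{+}=[0,\infty)$, $\mathbb{N}^{*}=\{1,2,\ldots\}$; $fx$ denotes $f(x)$, $fgx$ denotes $f(g(x))$, and $d^{q}(x,y)=(d(x,y))^{q}$. $\mathcal{F}$ is the family of maps $F:\mathbb{R}^{+}\to\mathbb{R}^{+}$ such that $F$ is upper semi-continuous and $F(t)<t$ for any $t>0$. Let $f,g$ be self-maps of a metric space $(\mathcal{X},d)$. - $f$ and $g$ are compatible if $\lim_{n\to\infty}d(fgx_n,gfx_n)=0$ whenever $(x_n)$ is a sequence in $\mathcal{X}$ such that $\lim_{n\to\infty}fx_n=\lim_{n\to\infty}gx_n=t$ for some $t\in\mathcal{X}$. - $f$ and $g$ are subsequentially continuous if there exists a sequence $(x_n)$ in $\mathcal{X}$ such that $\lim_{n\to\infty}fx_n=\lim_{n\to\infty}gx_n=t$ for some $t\in\mathcal{X}$, $\lim_{n\to\infty}fgx_n=ft$ and $\lim_{n\to\infty}gfx_n=gt$. - A coincidence point of $f$ and $g$ is a point $x$ with $fx=gx$; a common fixed point of a family of self-maps is a point fixed by every map in the family. *)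

(* Defs.v *)
From HB Require Import structures.
From mathcomp Require Export all_boot all_order all_algebra.
From mathcomp Require Export all_classical all_reals all_analysis.
Export numFieldNormedType.Exports.
Export Order.TTheory GRing.Theory Num.Theory.

Set Implicit Arguments.
Unset Strict Implicit.
Unset Printing Implicit Defensive.

Local Open Scope classical_set_scope.
Local Open Scope ring_scope.

Definition compatible (R : realType) (X : metricType R) (f g : X -> X) : Prop :=
  forall (x : nat -> X) (t : X),
    f (x n) @[n --> \oo] --> t ->
    g (x n) @[n --> \oo] --> t ->
    mdist (f (g (x n))) (g (f (x n))) @[n --> \oo] --> (0 : R).

Definition subsequentially_continuous (R : realType) (X : metricType R)
    (f g : X -> X) : Prop :=
  exists (x : nat -> X) (t : X),
    [/\ f (x n) @[n --> \oo] --> t,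
        g (x n) @[n --> \oo] --> t,
        f (g (x n)) @[n --> \oo] --> f t &
        g (f (x n)) @[n --> \oo] --> g t].

Definition coincidence_point (X : Type) (f g : X -> X) (x : X) : Prop :=
  f x = g x.

(* Upper semicontinuity of the restriction of f to A, for the subspace topology
   of A; dual to the library's lower_semicontinuous. *)
Definition upper_semicontinuous_on (R : realType) (A : set R) (f : R -> R) :
    Prop :=
  forall x a, A x -> f x < a -> \forall y \near within A (nbhs x), f y < a.

(* A map from [0, +oo[ to itself is represented by a function R -> R whose
   values at negative arguments are irrelevant. *)
Definition family_F (R : realType) : set (R -> R) :=
  [set F | [/\ forall t, 0 <= t -> 0 <= F t,
               upper_semicontinuous_on `[0, +oo[ F &
               forall t, 0 < t -> F t < t]].

(* Main.v *)
Require Import Defs.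
From mathcomp Require Import lra.

Set Implicit Arguments.
Unset Strict Implicit.
Unset Printing Implicit Defensive.

Local Open Scope classical_set_scope.
Local Open Scope ring_scope.

(** Compatibility and subsequential continuity of [(f, h)] give a sequence along
    which [f] and [h] tend to some [t], with [f t = h t].  The contractive
    condition forces two limits [A] and [B] to coincide as soon as [f, h] both
    tend to [A] along one sequence and [g, k] both tend to [B] along another: the
    argument of [F] then tends to [d(A, B)^p], so upper semicontinuity gives
    [d(A, B)^p <= F (d(A, B)^p)], which is impossible unless [A = B].
    Coincidence points yield such limits through constant sequences, so this
    single fact identifies [t], [f t], their analogues for [(g, k)], and any two
    common fixed points. *)

Lemma cvg_maxr (R : realType) (T : Type) (G : set_system T) (FG : Filter G)
    (u v : T -> R) (a b : R) :
  u n @[n --> G] --> a -> v n @[n --> G] --> b ->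
  Num.max (u n) (v n) @[n --> G] --> Num.max a b.
Proof.
move=> ua vb; under eq_fun do rewrite maxr_absE; rewrite maxr_absE.
by apply: cvgMl; apply: cvgD; [apply: cvgD|apply: cvg_norm; apply: cvgB].
Qed.

(** Square root and natural powers are continuous everywhere, so limits can be taken even where the
    distance tends to 0, as happens for [mdist (f x) (h x)]. *)
Lemma powR_half (R : realType) (x : R) (p : nat) : 0 <= x ->
  x `^ (p%:R / 2) = Num.sqrt x ^+ p.
Proof.
by move=> x0; rewrite mulrC powRrM powR12_sqrt// powR_mulrn// sqrtr_ge0.
Qed.

Lemma cvg_mdist (R : realType) (X : metricType R) (T : Type) (G : set_system T)
    (FG : Filter G) (x y : T -> X) (a b : X) :
  x n @[n --> G] --> a -> y n @[n --> G] --> b ->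
  mdist (x n) (y n) @[n --> G] --> mdist a b.
Proof.
move=> xa yb; apply/cvgrPdist_le => e e0.
have e20 : 0 < e / 2 by rewrite divr_gt0.
near=> n.
have h1 : mdist a (x n) <= e / 2.
  by near: n; exact: metricType_numDomainType.cvgr_dist_le.
have h2 : mdist b (y n) <= e / 2.
  by near: n; exact: metricType_numDomainType.cvgr_dist_le.
(* These four triangles give the quadrilateral inequality: the two distances differ by at most
   [mdist a (x n) + mdist b (y n)]. *)
have := metric_triangle a (x n) b; have := metric_triangle (x n) (y n) b.
have := metric_triangle (x n) a (y n); have := metric_triangle a b (y n).
rewrite (metric_sym (x n) a) (metric_sym (y n) b) => t1 t2 t3 t4.
by rewrite ler_norml; apply/andP; split; lra.
Unshelve. all: by end_near. Qed.

(** The distances between [f (h (x n))] and [h (f (x n))] tend to [mdist (f t) (h t)] by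
    subsequential continuity and to 0 by compatibility. The sequence is kept because the contraction
    is later applied along it. *)
Lemma coincidence_of_subsequential_limit (R : realType) (X : metricType R)
    (f h : X -> X) :
  compatible f h -> subsequentially_continuous f h ->
  exists (x : nat -> X) (t : X),
    [/\ f (x n) @[n --> \oo] --> t, h (x n) @[n --> \oo] --> t & f t = h t].
Proof.
move=> fh [x [t [fx hx fhx hfx]]]; exists x, t; split=> //.
apply: mdist_positivity; have lim_dist := cvg_mdist _ fhx hfx.
exact: (norm_cvg_unique (lim_dist _) (fh _ _ fx hx)).
Qed.

Section Contraction.
Variables (R : realType) (X : metricType R) (f g h k : X -> X).
Variables (F : R -> R) (p : nat) (a alpha beta : R).

Definition contraction_bound (x y : X) : R :=
  a * mdist (h x) (k y) ^+ p +
  (1 - a) *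
  Num.max (alpha * mdist (f x) (h x) ^+ p)
 (Num.max (beta * mdist (g y) (k y) ^+ p)
 (Num.max (mdist (f x) (h x) `^ (p%:R / 2) *
           mdist (f x) (k y) `^ (p%:R / 2))
 (Num.max (mdist (f x) (k y) `^ (p%:R / 2) *
           mdist (h x) (g y) `^ (p%:R / 2))
          (2^-1 * (mdist (f x) (h x) ^+ p + mdist (g y) (k y) ^+ p))))).

Hypothesis p0 : (0 < p)%N.

Lemma contraction_bound_cvg (x y : nat -> X) (A B : X) :
  f (x n) @[n --> \oo] --> A -> h (x n) @[n --> \oo] --> A ->
  g (y n) @[n --> \oo] --> B -> k (y n) @[n --> \oo] --> B ->
  contraction_bound (x n) (y n) @[n --> \oo] --> mdist A B ^+ p.
Proof.
move=> fA hA gB kB.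
have cX (u : nat -> R) (l : R) : u n @[n --> \oo] --> l ->
    u n ^+ p @[n --> \oo] --> l ^+ p.
  by move=> ul; exact: (cvg_comp _ _ ul (@exprn_continuous _ p l)).
have cS (u v : nat -> X) (U V : X) : u n @[n --> \oo] --> U ->
    v n @[n --> \oo] --> V ->
    mdist (u n) (v n) `^ (p%:R / 2) @[n --> \oo] -->
      Num.sqrt (mdist U V) ^+ p.
  move=> uU vV; under eq_fun do rewrite powR_half ?mdist_ge0//.
  apply: (cX); exact: (cvg_comp _ _ (cvg_mdist _ uU vV) (@sqrt_continuous _ _)).
have cM (c l : R) (u : nat -> R) : u n @[n --> \oo] --> l ->
    c * u n @[n --> \oo] --> c * l by move=> ?; apply: cvgMr.
(* The limit is put in the shape of the bound, so that each term converges separately. Powers of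
   [mdist A A] and [mdist B B] vanish since [0 < p], the fourth entry of the maximum is
   [mdist A B ^+ p], and the weights [a] and [1 - a] add up to 1. *)
have -> : mdist A B ^+ p =
  a * mdist A B ^+ p + (1 - a) *
  Num.max (alpha * mdist A A ^+ p)
 (Num.max (beta * mdist B B ^+ p)
 (Num.max (Num.sqrt (mdist A A) ^+ p * Num.sqrt (mdist A B) ^+ p)
 (Num.max (Num.sqrt (mdist A B) ^+ p * Num.sqrt (mdist A B) ^+ p)
          (2^-1 * (mdist A A ^+ p + mdist B B ^+ p))))).
  rewrite -expr2 exprAC sqr_sqrtr ?mdist_ge0// !mdistxx sqrtr0.
  rewrite expr0n eqn0Ngt p0 /= addr0 !mulr0 mul0r.
  have D0 : 0 <= mdist A B ^+ p by rewrite exprn_ge0 ?mdist_ge0.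
  by rewrite (max_l D0) !(max_r D0) -mulrDl addrC subrK mul1r.
apply: cvgD; first by apply: (cM); apply: (cX); exact: cvg_mdist.
apply: (cM); apply: cvg_maxr; first by apply: (cM); apply: (cX); exact: cvg_mdist.
apply: cvg_maxr; first by apply: (cM); apply: (cX); exact: cvg_mdist.
apply: cvg_maxr; first by apply: cvgM; exact: cS.
apply: cvg_maxr; first by apply: cvgM; exact: cS.
by apply: (cM); apply: cvgD; apply: (cX); exact: cvg_mdist.
Qed.

Hypotheses (FF : family_F F) (a01 : 0 < a < 1) (alpha0 : 0 < alpha).
Hypothesis contraction : forall x y,
  mdist (f x) (g y) ^+ p <= F (contraction_bound x y).

(** Semicontinuity of [F] is assumed only relative to the nonnegative reals, so the bound must be
    known to stay there. The first entry already makes the maximum nonnegative. *)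
Lemma contraction_bound_ge0 x y : 0 <= contraction_bound x y.
Proof.
have /andP[a0 a1] := a01.
have D0 u v : 0 <= mdist u v ^+ p by rewrite exprn_ge0 ?mdist_ge0.
apply: addr_ge0; first by rewrite mulr_ge0 ?D0 ?ltW.
apply: mulr_ge0; first by rewrite subr_ge0 ltW.
by rewrite le_max mulr_ge0 ?D0 // ltW.
Qed.

Lemma contraction_limits_eq (x y : nat -> X) (A B : X) :
  f (x n) @[n --> \oo] --> A -> h (x n) @[n --> \oo] --> A ->
  g (y n) @[n --> \oo] --> B -> k (y n) @[n --> \oo] --> B ->
  A = B.
Proof.
move=> fA hA gB kB; apply/eqP; rewrite -[_ == _]negbK -mdist_gt0.
apply/negP => D0; have [_ usc Flt] := FF.
have Dp0 : 0 < mdist A B ^+ p by rewrite exprn_gt0.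
(* The midpoint [c] leaves room on both sides: semicontinuity keeps [F] of the bound below [c]
   eventually, so the limit of the distances is at most [c], below its actual value. *)
have [c Fc cD] : exists2 c, F (mdist A B ^+ p) < c & c < mdist A B ^+ p.
  exists ((F (mdist A B ^+ p) + mdist A B ^+ p) / 2).
  - by have := Flt _ Dp0; lra.
  - by have := Flt _ Dp0; lra.
have Dpin : `[0, +oo[%classic (mdist A B ^+ p).
  by rewrite /= in_itv /= andbT ltW.
have bound_cvg := contraction_bound_cvg fA hA gB kB.
have ubound : \forall n \near \oo, F (contraction_bound (x n) (y n)) < c.
  have near_bound : \forall n \near \oo,
      `[0, +oo[%classic (contraction_bound (x n) (y n)) ->
      F (contraction_bound (x n) (y n)) < c.
    exact: (bound_cvg _ (usc _ _ Dpin Fc)).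
  apply: filterS near_bound => n; apply.
  by rewrite /= in_itv /= andbT contraction_bound_ge0.
have dist_cvg : mdist (f (x n)) (g (y n)) ^+ p @[n --> \oo] --> mdist A B ^+ p.
  exact: (cvg_comp _ _ (cvg_mdist _ fA gB) (@exprn_continuous _ p _)).
suff : mdist A B ^+ p <= c by rewrite leNgt cD.
rewrite -(cvg_lim _ dist_cvg)//; apply: limr_le; first exact: cvgP dist_cvg.
apply: filterS ubound => n /ltW; exact: le_trans.
Qed.

End Contraction.

Theorem mainTheorem2 (R : realType) (X : metricType R) (f g h k : X -> X)
  (fh_compat : compatible f h) (fh_subseq : subsequentially_continuous f h)
  (gk_compat : compatible g k) (gk_subseq : subsequentially_continuous g k) :
  [/\ exists x : X, coincidence_point f h x,
      exists x : X, coincidence_point g k x &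
      forall (F : R -> R) (p : nat) (a alpha beta : R),
        family_F F -> (0 < p)%N -> 0 < a < 1 ->
        0 < alpha <= 1 -> 0 < beta <= 1 ->
        (forall x y : X,
          mdist (f x) (g y) ^+ p <=
          F (a * mdist (h x) (k y) ^+ p +
             (1 - a) *
             Num.max (alpha * mdist (f x) (h x) ^+ p)
            (Num.max (beta * mdist (g y) (k y) ^+ p)
            (Num.max (mdist (f x) (h x) `^ (p%:R / 2) *
                      mdist (f x) (k y) `^ (p%:R / 2))
            (Num.max (mdist (f x) (k y) `^ (p%:R / 2) *
                      mdist (h x) (g y) `^ (p%:R / 2))
                     (2^-1 * (mdist (f x) (h x) ^+ p +
                              mdist (g y) (k y) ^+ p))))))) ->
        exists! z : X, [/\ f z = z, g z = z, h z = z & k z = z]].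
Proof.
have [x [t [fxt hxt fht]]] :=
  coincidence_of_subsequential_limit fh_compat fh_subseq.
have [y [s [gys kys gks]]] :=
  coincidence_of_subsequential_limit gk_compat gk_subseq.
split; [by exists t|by exists s|].
move=> F p a alpha beta FF p0 a01 /andP[alpha0 _] _ contr.
have lim_eq := contraction_limits_eq p0 FF a01 alpha0 contr.
have cst (u v : X) : u = v -> (fun=> u) n @[n --> \oo] --> v.
  by move=> ->; exact: cvg_cst.
have ts : t = s by exact: lim_eq fxt hxt gys kys.
(* Since [g s = k s], the constant sequence at [s] serves the pair [(g, k)] with limit [g s]; next,
   [t] does the same for [(f, h)]. *)
have tgs : t = g s.
  by apply: (lim_eq x (fun=> s)) => //; exact: cst.
have fts : f t = s.
  by apply: (lim_eq (fun=> t) y) => //; exact: cst.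
exists t; split; first by split; rewrite -?fht ?fts // ts -?gks -tgs.
(* Uniqueness compares [t], as a fixed point of [f] and [h], with [z], as one of [g] and [k]. *)
move=> z [fz gz hz kz].
by apply: (lim_eq (fun=> t) (fun=> z)); apply: cst => //; rewrite -?fht fts.
Qed.
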